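(* Let $k\ge2$ be an integer. Let $a:\mathbb{N}\to\mathbb{C}$ be a bounded arithmetic function of $k$-th power invariant average under multiplications, i.e. the limit $\lim_{N\to\infty}\frac1N\sum_{n=1}^N a(n^k)$ exists and, for every $m\in\mathbb{N}$, $$\lim_{N\to\infty}\frac1N\sum_{n=1}^N a(n^k m)=\lim_{N\to\infty}\frac1N\sum_{n=1}^N a(n^k).$$ Then $$\lim_{N\to\infty}\ \underset{\substack{n\in[N]\\ n\text{ is }k\text{-full}}}{\mathbb{E}}a(n)=\lim_{N\to\infty}\ \underset{n\in[N]}{\mathbb{E}}\,a(n^k).$$
   Context: $\mathbb{N}=\{1,2,3,\dots\}$ and $[N]=\{1,\dots,N\}$. For a finite nonempty set $B$ and $f:B\to\mathbb{C}$, $\mathbb{E}_{x\in B}f(x)=\frac1{|B|}\sum_{x\in B}f(x)$. Accordingly the left-hand average is over the set of $k$-full integers in $[N]$. A natural number $n$ is $k$-full if $p^k\mid n$ for every prime factor $p$ of $n$ (so $1$ is $k$-full). *)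

(* Defs.v *)
From mathcomp Require Import all_boot all_order all_algebra complex.
From mathcomp Require Import all_classical all_reals all_analysis.
Import Order.TTheory GRing.Theory Num.Theory.
Import numFieldNormedType.Exports.

Set Implicit Arguments.
Unset Strict Implicit.
Unset Printing Implicit Defensive.

Local Open Scope classical_set_scope.
Local Open Scope ring_scope.
Local Open Scope complex_scope.

(* The condition 0 < n excludes n = 0, for which primes n is empty. *)
Definition kfull (k n : nat) : bool :=
  ((0 < n) && all (fun p => p ^ k %| n) (primes n))%N.

(* Finite sets of natural numbers are given by duplicate-free lists; [N] is
   iota 1 N.  For B empty the value is 0.  The type R[i]^o is R[i] with the
   topology of its norm, which R[i] itself does not carry canonically. *)
Definition mean (R : realType) (B : seq nat) (f : nat -> R[i]) : R[i]^o :=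
  (size B)%:R^-1 * \sum_(n <- B) f n.

(* Functions on the positive integers are represented by functions on nat
   whose value at 0 is irrelevant. *)
Definition bounded_arithmetic (R : realType) (a : nat -> R[i]) : Prop :=
  exists M : R, forall n : nat, (0 < n)%N -> `|a n| <= M%:C.

Definition kth_power_invariant_average (R : realType) (k : nat)
    (a : nat -> R[i]) : Prop :=
  cvgn (fun N => mean (iota 1 N) (fun n => a (n ^ k)%N)) /\
  forall m : nat, (0 < m)%N ->
    (fun N => mean (iota 1 N) (fun n => a (n ^ k * m)%N)) @ \oo -->
      limn (fun N => mean (iota 1 N) (fun n => a (n ^ k)%N)).

(* Main.v *)
Require Import Defs.
From mathcomp Require Import all_boot all_order all_algebra complex.
From mathcomp Require Import all_classical all_reals all_analysis.
From mathcomp Require Import zify ring.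
Import Order.TTheory GRing.Theory Num.Theory.
Import numFieldNormedType.Exports.

(** Every [k]-full number is uniquely [b ^ k * m] with [b > 0] and [m] a core:
    a number whose nonzero prime exponents all lie strictly between [k] and
    [2 * k].  (At each prime, the exponent of [m] is [0] or [k + r] according to
    the residue [r] of the exponent of [n] modulo [k].)  Hence, for any limit
    candidate [L], the sum of [a n - L] over the [k]-full [n <= N] splits into
    fibres,
      \sum_(m core) S m (kroot k (N %/ m)),
    where [S m x] is the sum of [a (b ^ k * m) - L] over [1 <= b <= x].  The
    hypothesis on [a] says exactly that [S m x = o(x)] for each fixed [m].

    Divide by [t = kroot k N], the integer part of the [k]-th root of [N].  The
    fibre of [m = 1] alone already contributes [t] elements, so it suffices that
    the sum over [m] of [|S m (kroot k (N %/ m))| / t] tends to [0].  Each term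
    does, because [kroot k (N %/ m) <= t], and as [a] is bounded the term of [m]
    is at most a constant times [m ^ (-1/k)].  Dominated convergence for series
    ([tannery]) then concludes, provided the sum of [m ^ (-1/k)] over the cores
    is finite ([sum_core_kthrootV_le]).

    That sum is bounded by its Euler product: with [w m = m ^ (-1/k)], the
    factor at [p] is [1 + \sum_(k < e < 2k) w p ^ e], which is at most
    [1 + k * w p ^ k.+1 <= expR (k * p ^ (-1-1/k))], and the exponents are
    summable ([core_sum_le_expR] and [sum_kthrootV_expS_le]). *)

Set Implicit Arguments.
Unset Strict Implicit.
Unset Printing Implicit Defensive.

Local Open Scope classical_set_scope.
Local Open Scope ring_scope.
Local Open Scope complex_scope.

(** * Decomposition of k-full numbers *)

Section Arith.
Local Open Scope nat_scope.

Definition core (k m : nat) : bool :=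
  (0 < m) && all (fun p => k < logn p m < k.*2) (primes m).

Lemma core_gt0 k m : core k m -> 0 < m.
Proof. by case/andP. Qed.

Lemma coreP k m :
  reflect (0 < m /\ forall p, logn p m = 0 \/ k < logn p m < k.*2) (core k m).
Proof.
apply: (iffP andP) => -[m_gt0 H]; split=> //.
  move=> p; case: (posnP (logn p m)) => [|lt0]; [by left | right].
  by apply: (allP H); rewrite -logn_gt0.
by apply/allP => p; rewrite -logn_gt0; case: (H p) => [->|].
Qed.

Lemma kfullP k n :
  reflect (0 < n /\ forall p, logn p n = 0 \/ k <= logn p n) (kfull k n).
Proof.
apply: (iffP andP) => -[n_gt0 H]; split=> //.
  move=> p; case: (posnP (logn p n)) => [|lt0]; [by left | right].
  move: lt0; rewrite logn_gt0 => pn; have := allP H _ pn.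
  by rewrite pfactor_dvdn //; move: pn; rewrite mem_primes => /andP[].
apply/allP => p pn; rewrite pfactor_dvdn //; last first.
  by move: pn; rewrite mem_primes => /andP[].
by case: (H p) => // p0; move: pn; rewrite -logn_gt0 p0.
Qed.

Lemma kfull_mul k b m : 0 < b -> core k m -> kfull k (b ^ k * m).
Proof.
move=> b_gt0 /coreP[m_gt0 Hm]; apply/kfullP.
rewrite muln_gt0 expn_gt0 b_gt0 m_gt0; split=> // p.
rewrite lognM ?expn_gt0 ?b_gt0 // lognX.
case: (posnP (logn p b)) => [->|pb]; first by have := Hm p; lia.
by right; rewrite (leq_trans _ (leq_addr _ _)) // leq_pmulr.
Qed.

(** Among the pairs [b], [n %/ b ^ k] with [n %/ b ^ k] still [k]-full, one with
    the largest [b] has a core as its second entry: a prime whose exponent is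
    [k] or at least [2 * k] could be moved into [b].  The induction on [n]
    performs these moves one at a time. *)
Lemma kfull_decomp k n : 0 < k -> kfull k n ->
  exists b m, [/\ 0 < b, core k m & n = b ^ k * m].
Proof.
move=> k_gt0; elim/ltn_ind: n => n IH fn; case: (boolP (core k n)) => [cn|ncn].
  by exists 1, n; rewrite exp1n mul1n.
have [n_gt0 Hn] := kfullP _ _ fn.
have /allPn[p pn Hp] : ~~ all (fun p => k < logn p n < k.*2) (primes n).
  by move: ncn; rewrite negb_and n_gt0.
have p_pr : prime p by move: pn; rewrite mem_primes => /andP[].
(* The exponent of p is k or at least 2 * k, so p ^ k can be split off. *)
have kp : k <= logn p n.
  by move: pn; rewrite -logn_gt0; case: (Hn p) => [->|].
have pkn : p ^ k %| n by rewrite pfactor_dvdn.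
have pk_gt1 : 1 < p ^ k by rewrite -(exp1n k) ltn_exp2r // prime_gt1.
have n'_gt0 : 0 < n %/ p ^ k.
  by rewrite (divn_gt0 _ (ltnW pk_gt1)); exact: dvdn_leq.
have [||b [m [b_gt0 cm e]]] := IH (n %/ p ^ k).
- by rewrite ltn_Pdiv.
- apply/kfullP; split=> // q; rewrite logn_div // lognX (logn_prime q p_pr).
  by case: (eqVneq q p) => [->|_]; [lia | have := Hn q; lia].
exists (p * b), m; split=> //; first by rewrite muln_gt0 prime_gt0.
by rewrite expnMn -mulnA -e mulnC divnK.
Qed.

(** At each prime the exponent of a core is determined by its residue modulo
    [k], which multiplication by a [k]-th power leaves unchanged. *)
Lemma core_decomp_inj k b m b' m' : 0 < k -> 0 < b -> 0 < b' ->
  core k m -> core k m' -> b ^ k * m = b' ^ k * m' -> b = b' /\ m = m'.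
Proof.
move=> k_gt0 b_gt0 b'_gt0 /coreP[m_gt0 Hm] /coreP[m'_gt0 Hm'] e.
have E p : k * logn p b + logn p m = k * logn p b' + logn p m'.
  by rewrite -!lognX -!lognM ?expn_gt0 ?b_gt0 ?b'_gt0 ?e.
have expE q v : v = 0 \/ k < v < k.*2 ->
    v = (0 < (k * q + v) %% k) * k + (k * q + v) %% k.
  rewrite (mulnC k q) modnMDl => -[->|/andP[lo hi]]; first by rewrite mod0n.
  have -> : v %% k = v - k.
    by rewrite -[in LHS](subnK (ltnW lo)) modnDr modn_small //; lia.
  by rewrite subn_gt0 lo mul1n subnKC // ltnW.
have Em p : logn p m = logn p m'.
  by rewrite (expE (logn p b) _ (Hm p)) (expE (logn p b') _ (Hm' p)) E.
by split; apply: eqn_from_log => // p; have := E p; rewrite Em => /addIn /eqP;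
  rewrite eqn_pmul2l // => /eqP.
Qed.

Definition kroot (k x : nat) : nat := \max_(b < x.+1 | b ^ k <= x) b.

Lemma leq_kroot k x b : 0 < k -> (b <= kroot k x) = (b ^ k <= x).
Proof.
move=> k_gt0; apply/idP/idP => h.
  have : kroot k x ^ k <= x.
    rewrite /kroot; elim/big_ind: _ => // [|u v hu hv].
      by rewrite exp0n.
    by rewrite /maxn; case: ifP.
  by apply: leq_trans; rewrite leq_exp2r.
have bx : b < x.+1.
  rewrite ltnS (leq_trans _ h) //.
  by case: b {h} => // b; rewrite -{1}(expn1 b.+1) leq_pexp2l.
by rewrite /kroot (leq_bigmax_cond (Ordinal bx)).
Qed.

Lemma leq_kroot_divn k N m b : 0 < k -> 0 < m ->
  (b <= kroot k (N %/ m)) = (b ^ k * m <= N).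
Proof. by move=> k_gt0 m_gt0; rewrite leq_kroot // leq_divRL. Qed.

(** Fibring of the [k]-full numbers up to [N] over their cores; the [b] that
    occur with [m] are an initial segment, so that each fibre sum is an
    ordinary average. *)
Lemma perm_kfull k N : 0 < k ->
  perm_eq [seq n <- iota 1 N | kfull k n]
    [seq b ^ k * m | m <- [seq m <- iota 1 N | core k m],
                     b <- iota 1 (kroot k (N %/ m))].
Proof.
move=> k_gt0; apply: uniq_perm.
- by rewrite filter_uniq // iota_uniq.
- apply: allpairs_uniq_dep.
  + by rewrite filter_uniq // iota_uniq.
  + by move=> m _; rewrite iota_uniq.
  move=> u v /allpairsPdep[m [b [mc bi ->]]].
  move=> /allpairsPdep[m' [b' [mc' bi' ->]]].
  move: mc bi mc' bi'; rewrite !mem_filter !mem_iota => /andP[mc _] /andP[b0 _].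
  move=> /andP[mc' _] /andP[b0' _] /= e.
  by have [-> ->] := core_decomp_inj k_gt0 b0 b0' mc mc' e.
move=> n; rewrite mem_filter mem_iota add1n ltnS.
apply/idP/allpairsPdep => [/andP[fn /andP[n_gt0 nN]]|[m [b [mc bi ->]]]].
  have [b [m [b_gt0 cm e]]] := kfull_decomp k_gt0 fn.
  have m_gt0 := core_gt0 cm.
  exists m, b; rewrite mem_filter !mem_iota !add1n !ltnS cm b_gt0 m_gt0 /=.
  split=> //; last by rewrite leq_kroot_divn // -e.
  by rewrite (leq_trans _ nN) // e leq_pmull // expn_gt0 b_gt0.
move: mc bi; rewrite mem_filter !mem_iota !add1n !ltnS => /and3P[cm m_gt0 _].
move=> /andP[b_gt0]; rewrite leq_kroot_divn // => ->.
by rewrite kfull_mul // muln_gt0 expn_gt0 b_gt0 m_gt0.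
Qed.

(** The induction step for sums over cores whose prime factors are bounded.
    For nonprime [y] the exponent [logn y m] is [0]: nothing is divided out. *)
Lemma core_coprime_part k y m :
  core k m -> (forall p, y < p -> logn p m = 0) ->
  let m' := m %/ y ^ logn y m in
  [/\ m = y ^ logn y m * m', core k m' & forall p, y <= p -> logn p m' = 0].
Proof.
move=> /coreP[m_gt0 Hm] small m'.
have yd : y ^ logn y m %| m by exact: pfactor_dvdnn.
have e : m = y ^ logn y m * m' by rewrite mulnC divnK.
have m'_gt0 : 0 < m' by move: m_gt0; rewrite {1}e muln_gt0 => /andP[].
have lE p : logn p m' = if p == y then 0 else logn p m.
  rewrite logn_div // lognX.
  have [y_pr|y_npr] := boolP (prime y); last first.
    rewrite [logn y m]lognE (negPf y_npr) mul0n subn0.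
    by case: (eqVneq p y) => [->|_] //; rewrite lognE (negPf y_npr).
  rewrite (logn_prime p y_pr); case: (eqVneq p y) => [->|_].
    by rewrite muln1 subnn.
  by rewrite muln0 subn0.
split=> //; first by apply/coreP; split=> // p; rewrite lE; case: eqP; [left|].
by move=> p yp; rewrite lE; case: eqVneq => // pny; apply: small; lia.
Qed.
End Arith.

(** * An Euler product over the cores *)

Section Euler.
Variables (R : realType) (k : nat) (w : nat -> R).
Hypothesis w_ge0 : forall m, 0 <= w m.
Hypothesis w_le1 : forall m, w m <= 1.
Hypothesis w1 : w 1%N = 1.
Hypothesis wM : forall m n, w (m * n)%N = w m * w n.

Lemma wX m e : w (m ^ e)%N = w m ^+ e.
Proof. by elim: e => [|e IH]; rewrite ?expn0 // expnS exprS wM IH. Qed.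

(** Upper half of the Euler product.  Stating it for arbitrary finite lists of
    cores with prime factors below [y] makes it inductive in [y]: dividing the
    members with [y]-exponent [e] by [y ^ e] gives a list for the smaller bound,
    and [e] can only be [0] or one of the [k - 1] values above [k].  The index
    [q] runs through all integers since only an upper bound is wanted. *)
Lemma core_sum_le_expR y (s : seq nat) : uniq s ->
  (forall m, m \in s -> core k m /\ forall p, (y <= p)%N -> logn p m = 0%N) ->
  \sum_(m <- s) w m <= expR (\sum_(0 <= q < y) k%:R * w q ^+ k.+1).
Proof.
elim: y s => [|y IH] s s_uniq Hs.
  rewrite big_nil expR0.
  have sub : {subset s <= [:: 1%N]}.
    move=> m /Hs [/core_gt0 m_gt0 m1]; rewrite inE; apply/eqP.
    by apply: eqn_from_log => // p; rewrite m1 // logn1.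
  case: s s_uniq sub {Hs} => [|x [|x' s]] /=; first by rewrite big_nil.
    by rewrite big_seq1.
  rewrite inE negb_or => /andP[/andP[xx' _] _] sub.
  move: xx'; have := sub x; have := sub x'.
  by rewrite !inE !eqxx orbT => /(_ isT)/eqP-> /(_ isT)/eqP->.
rewrite big_nat_recr //=; set E := (X in expR (X + _)).
have class_le e : \sum_(m <- s | logn y m == e) w m <= w y ^+ e * expR E.
  have -> : \sum_(m <- s | logn y m == e) w m =
     w y ^+ e * \sum_(m <- [seq (m %/ y ^ e)%N | m <- s & logn y m == e]) w m.
    rewrite big_map big_filter big_distrr /= -big_filter -[RHS]big_filter.
    apply: eq_big_seq => m; rewrite mem_filter => /andP[/eqP <- /Hs [cm sm]].
    have [e1 _ _] := core_coprime_part cm sm.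
    by rewrite {1}e1 wM wX.
  apply: ler_wpM2l; first by rewrite exprn_ge0.
  apply: IH.
    rewrite map_inj_in_uniq ?filter_uniq // => m m'.
    rewrite !mem_filter => /andP[/eqP em /Hs [cm sm]].
    move=> /andP[/eqP em' /Hs [cm' sm']].
    have [e1 _ _] := core_coprime_part cm sm.
    have [e2 _ _] := core_coprime_part cm' sm'.
    by move=> eq; rewrite e1 e2 em em' eq.
  move=> _ /mapP[m + ->]; rewrite mem_filter => /andP[/eqP <- /Hs [cm sm]].
  by have [_ ? ?] := core_coprime_part cm sm.
have -> : \sum_(m <- s) w m =
    \sum_(m <- s | logn y m == 0%N) w m +
    \sum_(e < k) \sum_(m <- s | logn y m == (k + e)%N) w m.
  rewrite (bigID (fun m => logn y m == 0%N)) /=; congr (_ + _).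
  rewrite (exchange_big_dep xpredT) //= big_mkcond /=.
  apply: eq_big_seq => m /Hs [/coreP[_ /(_ y) Hm] _].
  case: (posnP (logn y m)) Hm => [-> _|l_gt0 [h|h]] /=; last 2 first.
  - by rewrite h in l_gt0.
  - have lt : (logn y m - k < k)%N by lia.
    rewrite (bigD1 (Ordinal lt)) /=; last by rewrite subnKC //; lia.
    rewrite big1 ?addr0 // => i /andP[/eqP e /eqP ni]; case: ni.
    by apply: val_inj => /=; lia.
  - by rewrite big1 // => i /eqP e; have := ltn_ord i; lia.
have : \sum_(e < k) \sum_(m <- s | logn y m == (k + e)%N) w m <=
    k%:R * w y ^+ k.+1 * expR E.
  have : \sum_(e < k) \sum_(m <- s | logn y m == (k + e)%N) w m <=
      \sum_(e < k) w y ^+ k.+1 * expR E.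
    apply: ler_sum => -[[|e] he] _ /=.
      (* Exponent exactly k does not occur in a core. *)
      rewrite addn0 big1_seq ?mulr_ge0 ?exprn_ge0 ?expR_ge0 // => m.
      by move=> /andP[/eqP e /Hs [/coreP[_ /(_ y)]]]; lia.
    apply: le_trans (class_le _) _; apply: ler_wpM2r; first exact: expR_ge0.
    by apply: ler_wiXn2l => //; lia.
  by rewrite sumr_const card_ord -[_ *+ k]mulr_natl mulrA.
move=> h; apply: le_trans (lerD (class_le 0%N) h) _.
rewrite expr0 -mulrDl mulrC expRD; apply: ler_wpM2l; first exact: expR_ge0.
exact: expR_ge1Dx.
Qed.
End Euler.

(** * Dominated convergence for series *)

Section Tannery.
Variable R : realType.

(** Tannery's theorem for nonnegative terms.  The range [d N] of summation is
    arbitrary because the dominating series controls every tail. *)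
Lemma tannery (u : nat -> nat -> R) (w : nat -> R) (C : R) (d : nat -> nat) :
  (forall m N, 0 <= u m N <= w m) ->
  (forall n, \sum_(0 <= m < n) w m <= C) ->
  (forall m, u m N @[N --> \oo] --> (0 : R)) ->
  (\sum_(0 <= m < d N) u m N) @[N --> \oo] --> (0 : R).
Proof.
move=> uw wC u0.
have w_ge0 m : 0 <= w m by have /andP[h1 h2] := uw m 0%N; exact: le_trans h2.
pose W n := \sum_(0 <= m < n) w m.
have Wmono : {homo W : m n / (m <= n)%N >-> m <= n}.
  move=> m n mn; rewrite /W (big_cat_nat (leq0n _) mn) //= lerDl.
  by apply: sumr_ge0.
have Wcvg : cvgn W.
  by apply: nondecreasing_is_cvgn => //; exists C => _ [n _ <-]; exact: wC.
have WS n : W n <= limn W by exact: nondecreasing_cvgn_le.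
apply/cvgrPdist_le => e e_gt0.
have e2_gt0 : 0 < e / 2 by rewrite divr_gt0.
have [Z _ HZ] := (cvgrPdist_le W (limn W)).1 Wcvg _ e2_gt0.
have {}HZ : limn W - W Z <= e / 2.
  exact: le_trans (ler_norm _) (HZ Z (leqnn Z)).
have tail N : \sum_(0 <= m < d N) u m N <=
              \sum_(0 <= m < Z) u m N + (limn W - W Z).
  have [dZ|/ltnW Zd] := leqP (d N) Z.
    rewrite (big_cat_nat (leq0n _) dZ) //= -addrA lerDl addr_ge0 ?subr_ge0 //.
    by apply: sumr_ge0 => m _; case/andP: (uw m N).
  rewrite (big_cat_nat (leq0n _) Zd) //= lerD2l.
  apply: (@le_trans _ _ (\sum_(Z <= m < d N) w m)).
    by apply: ler_sum => m _; case/andP: (uw m N).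
  rewrite lerBrDl; apply: le_trans (WS (d N)).
  by rewrite /W [X in _ <= X](big_cat_nat (leq0n _) Zd).
have hd : (\sum_(0 <= m < Z) u m N) @[N --> \oo] --> (0 : R).
  elim: (Z) => [|z IH].
    by under eq_fun do rewrite big_nil; exact: cvg_cst.
  have -> : (fun N => \sum_(0 <= m < z.+1) u m N) =
      (fun N => \sum_(0 <= m < z) u m N) + u z.
    by apply/funext => N; rewrite big_nat_recr.
  by have h := cvgD IH (u0 z); rewrite addr0 in h; exact: h.
have hd2 := (cvgrPdist_le _ _).1 hd _ e2_gt0.
near=> N.
have hN : `|\sum_(0 <= m < Z) u m N| <= e / 2.
  by rewrite -normrN -sub0r; near: N; exact: hd2.
rewrite sub0r normrN.
rewrite ger0_norm; last by apply: sumr_ge0 => m _; case/andP: (uw m N).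
apply: le_trans (tail N) _; rewrite [leRHS](splitr e) lerD //.
exact: le_trans (ler_norm _) hN.
Unshelve. all: end_near.
Qed.
End Tannery.

(** * Summability of the weights m ^ (-1/k) over the cores *)

Section RootWeight.
Variables (R : realType) (k : nat).
Hypothesis k_gt0 : (0 < k)%N.

Definition kthroot (m : nat) : R := m%:R `^ k%:R^-1.

Lemma kthroot_ge0 m : 0 <= kthroot m. Proof. exact: powR_ge0. Qed.

Lemma kthrootX m : kthroot m ^+ k = m%:R.
Proof.
rewrite -powR_mulrn ?kthroot_ge0 // /kthroot -powRrM mulVf ?powRr1 //.
by rewrite pnatr_eq0 -lt0n.
Qed.

Lemma kthrootM m n : kthroot (m * n) = kthroot m * kthroot n.
Proof. by rewrite /kthroot natrM powRM. Qed.

Lemma ler_kthroot m n : (kthroot m <= kthroot n) = (m <= n)%N.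
Proof.
by rewrite -(@ler_pXn2r _ k) ?nnegrE ?kthroot_ge0 // !kthrootX ler_nat.
Qed.

Lemma kthroot1 : kthroot 1 = 1.
Proof. by rewrite /kthroot powR1. Qed.

Lemma kthroot0 : kthroot 0 = 0.
Proof. by rewrite /kthroot powR0 // invr_eq0 pnatr_eq0 -lt0n. Qed.

Lemma kthroot_gt0 m : (0 < m)%N -> 0 < kthroot m.
Proof.
by move=> m_gt0; rewrite (lt_le_trans ltr01) // -kthroot1 ler_kthroot.
Qed.

Lemma kthrootV_le1 m : (kthroot m)^-1 <= 1.
Proof.
case: m => [|m]; first by rewrite kthroot0 invr0.
by rewrite invf_le1 ?kthroot_gt0 // -kthroot1 ler_kthroot.
Qed.

(** With [A] and [B] the [k]-th roots of [q] and [q.+1], the mean value estimate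
    [1 = B ^+ k - A ^+ k <= (B - A) * k * B ^+ k.-1], divided by [B ^+ k.+1],
    bounds [q.+1 ^ (-1-1/k)] by a telescoping difference. *)
Lemma kthrootV_expS_le q : (0 < q)%N ->
  (kthroot q.+1)^-1 ^+ k.+1 <= k%:R * ((kthroot q)^-1 - (kthroot q.+1)^-1).
Proof.
move=> q_gt0; set A := kthroot q; set B := kthroot q.+1.
have A_gt0 : 0 < A by exact: kthroot_gt0.
have B_gt0 : 0 < B by exact: kthroot_gt0.
have AB : A <= B by rewrite ler_kthroot.
(* Every term of the factorisation of B ^+ k - A ^+ k is at most B ^+ k.-1. *)
have mv : 1 <= (B - A) * (k%:R * B ^+ k.-1).
  have {1}-> : 1 = B ^+ k - A ^+ k by rewrite !kthrootX -natrB // subSnn.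
  rewrite subrXX ler_wpM2l ?subr_ge0 //.
  have -> : k%:R * B ^+ k.-1 = \sum_(i < k) B ^+ k.-1.
    by rewrite sumr_const card_ord mulr_natl.
  apply: ler_sum => i _.
  have ik : (i <= k.-1)%N by have := ltn_ord i; lia.
  rewrite -[in leRHS](subnK ik) exprD ler_wpM2l ?exprn_ge0 ?(ltW B_gt0) //.
  by apply: lerXn2r => //; rewrite nnegrE ltW.
have -> : A^-1 - B^-1 = (B - A) * (A^-1 * B^-1).
  by field; rewrite !gt_eqF.
apply: (@le_trans _ _ (k%:R * ((B - A) * (B^-1 * B^-1)))); last first.
  rewrite ler_wpM2l ?ler0n // ler_wpM2l ?subr_ge0 // ler_wpM2r //.
    by rewrite invr_ge0 ltW.
  by rewrite lef_pV2.
have Bk : B ^+ k.-1 * B^-1 ^+ k.+1 = B^-1 * B^-1.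
  have -> : k.+1 = (k.-1 + 2)%N by lia.
  by rewrite exprD mulrA -exprMn divff ?gt_eqF // expr1n mul1r.
rewrite -Bk -[leLHS]mul1r.
have -> : k%:R * ((B - A) * (B ^+ k.-1 * B^-1 ^+ k.+1)) =
  (B - A) * (k%:R * B ^+ k.-1) * B^-1 ^+ k.+1 by ring.
by rewrite ler_wpM2r // exprn_ge0 // invr_ge0 ltW.
Qed.

Lemma sum_kthrootV_expS_le y :
  \sum_(0 <= q < y) (kthroot q)^-1 ^+ k.+1 <= 1 + k%:R.
Proof.
case: y => [|[|y]]; first by rewrite big_nil addr_ge0.
  by rewrite big_nat1 kthroot0 invr0 expr0n /= addr_ge0.
apply: (@le_trans _ _ (1 + k%:R * (1 - (kthroot y.+1)^-1))); last first.
  by rewrite lerD2l ler_piMr // lerBlDr lerDl invr_ge0 kthroot_ge0.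
elim: y => [|y IH].
  rewrite big_nat_recr // big_nat1 /= kthroot0 invr0 expr0n kthroot1 invr1.
  by rewrite expr1n /= add0r subrr mulr0 addr0.
rewrite big_nat_recr //=.
apply: le_trans (lerD IH (kthrootV_expS_le (ltn0Sn y))) _.
by rewrite -addrA -mulrDr addrA subrK.
Qed.

(** In real terms [kroot k (N %/ m) <= (N / m) ^ (1/k)]; the factor [2] pays for
    replacing [N ^ (1/k) < kroot k N + 1] by a multiple of [kroot k N]. *)
Lemma kroot_divn_le N m : (0 < m)%N ->
  (kroot k (N %/ m))%:R <= 2 * (kroot k N)%:R * (kthroot m)^-1.
Proof.
move=> m_gt0; set x := kroot _ _; set t := kroot k N.
have [N0|N_gt0] := posnP N.
  have -> : x = 0%N.
    apply/eqP; rewrite -leqn0 leqNgt leq_kroot_divn // N0 exp1n mul1n.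
    by rewrite -ltnNge.
  by rewrite mulr_ge0 ?invr_ge0 ?kthroot_ge0.
have t_gt0 : (0 < t)%N by rewrite leq_kroot // exp1n.
have hx : (x ^ k * m <= N)%N by rewrite -leq_kroot_divn.
have ht : (N < t.+1 ^ k)%N by rewrite ltnNge -leq_kroot // ltnn.
rewrite ler_pdivlMr ?kthroot_gt0 //.
apply: (@le_trans _ _ t.+1%:R); last by rewrite -natrM ler_nat; lia.
rewrite -(@ler_pXn2r _ k) ?nnegrE ?mulr_ge0 ?kthroot_ge0 //.
by rewrite exprMn kthrootX -!natrX -natrM ler_nat ltnW // (leq_ltn_trans hx).
Qed.

Lemma sum_core_kthrootV_le :
  exists C, forall n, \sum_(0 <= m < n | core k m) (kthroot m)^-1 <= C.
Proof.
exists (expR (k%:R * (1 + k%:R))) => n.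
rewrite -big_filter.
apply: (@le_trans _ _ (expR (\sum_(0 <= q < n) k%:R * (kthroot q)^-1 ^+ k.+1))).
  apply: (@core_sum_le_expR R k (fun m => (kthroot m)^-1)).
  - by move=> m; rewrite invr_ge0 kthroot_ge0.
  - exact: kthrootV_le1.
  - by rewrite kthroot1 invr1.
  - by move=> m m'; rewrite kthrootM invfM.
  - by rewrite filter_uniq // iota_uniq.
  move=> m; rewrite mem_filter mem_index_iota => /andP[cm /andP[_ mn]].
  split=> // p np; have m_gt0 := core_gt0 cm.
  apply/eqP; rewrite -leqn0 leqNgt logn_gt0; apply/negP => pm.
  by move: pm; rewrite mem_primes => /and3P[_ _ /(dvdn_leq m_gt0)]; lia.
by rewrite ler_expR -big_distrr /= ler_wpM2l // sum_kthrootV_expS_le.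
Qed.
End RootWeight.

(** * Complex means *)

Section ComplexMeans.
Variable R : realType.
Implicit Types (z : R[i]) (f g : nat -> R[i]).
Import Normc.

Lemma norm_normc z : `|z| = (normc z)%:C. Proof. by []. Qed.

Lemma normc_ge0 z : 0 <= normc z.
Proof. by rewrite -lecR -norm_normc normr_ge0. Qed.

Lemma normc_nat n : normc (n%:R : R[i]) = n%:R.
Proof. by apply: complexI; rewrite -norm_normc normr_nat rmorph_nat. Qed.

(** The norm of [R[i]] takes values in [R[i]]; this transfers limits to [R],
    where suprema, squeezing and [tannery] are available. *)
Lemma cvg_normc (f : nat -> R[i]^o) (l : R[i]^o) :
  f @ \oo --> l <-> normc (f n - l) @[n --> \oo] --> (0 : R).
Proof.
split.
  move=> /cvgrPdist_le fl; apply/cvgrPdist_le => e e_gt0.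
  have e_gt0' : 0 < e%:C by rewrite ltcR.
  near=> n; rewrite sub0r normrN ger0_norm ?normc_ge0 //.
  by rewrite -lecR -norm_normc distrC; near: n; exact: fl.
move=> /cvgrPdist_le fl; apply/cvgrPdist_le => -[e e'].
rewrite ltcE /= => /andP[/eqP -> e_gt0].
near=> n; rewrite distrC norm_normc lecR.
rewrite -(ger0_norm (normc_ge0 _)) -normrN -sub0r.
by near: n; exact: fl.
Unshelve. all: end_near.
Qed.

Lemma mean_sub (B : seq nat) f z : (0 < size B)%N ->
  mean B f - z = (size B)%:R^-1 * \sum_(n <- B) (f n - z).
Proof.
move=> B0; rewrite sumrB big_const_seq count_predT iter_addr_0.
rewrite mulrBr -[z *+ _]mulr_natl mulKf //.
by rewrite pnatr_eq0 -lt0n.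
Qed.

Lemma normc_mean_sub (B : seq nat) f z :
  normc (\sum_(n <- B) (f n - z)) = (size B)%:R * normc (mean B f - z).
Proof.
have [B0|B0] := posnP (size B).
  by rewrite B0 mul0r (size0nil B0) big_nil normc0.
rewrite mean_sub // normcM normcV normc_nat mulVKf //.
by rewrite pnatr_eq0 -lt0n.
Qed.

Lemma normc_sum_le (I : Type) (r : seq I) (F : I -> R[i]) :
  normc (\sum_(i <- r) F i) <= \sum_(i <- r) normc (F i).
Proof.
rewrite -lecR -norm_normc (le_trans (ler_norm_sum _ _ _)) // rmorph_sum.
exact: lexx.
Qed.
End ComplexMeans.

(** * The mean over k-full numbers *)

Theorem theorem1p4 (R : realType) (k : nat) (hk : (2 <= k)%N)
    (a : nat -> R[i])
    (ha : bounded_arithmetic a)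
    (hinv : kth_power_invariant_average k a) :
  (fun N : nat => mean [seq n <- iota 1 N | kfull k n] a) @ \oo -->
    limn (fun N : nat => mean (iota 1 N) (fun n => a (n ^ k)%N)).
Proof.
case: hinv => _; set L := limn _ => hinv.
have k_gt0 : (0 < k)%N by lia.
have [M HM] := ha.
pose K : R := M + Normc.normc L.
have HK n : (0 < n)%N -> Normc.normc (a n - L) <= K.
  move=> n_gt0; rewrite /K -lecR rmorphD -!norm_normc.
  by apply: le_trans (ler_normB _ _) _; rewrite lerD2r HM.
have K_ge0 : 0 <= K := le_trans (normc_ge0 _) (HK 1%N isT).
pose D m x := Normc.normc (\sum_(b <- iota 1 x) (a (b ^ k * m)%N - L)).
pose u m N : R :=
  if core k m then D m (kroot k (N %/ m)) / (kroot k N)%:R else 0.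
pose w m : R := if core k m then 2 * K * (kthroot R k m)^-1 else 0.
have D_le m x : (0 < m)%N -> D m x <= x%:R * K.
  move=> m_gt0; apply: le_trans (normc_sum_le _ _) _.
  have -> : x%:R * K = \sum_(b <- iota 1 x) K.
    by rewrite big_const_seq count_predT size_iota iter_addr_0 mulr_natl.
  rewrite big_seq [leRHS]big_seq; apply: ler_sum => b.
  rewrite mem_iota => /andP[b_gt0 _].
  by apply: HK; rewrite muln_gt0 expn_gt0 b_gt0 m_gt0.
have uw m N : 0 <= u m N <= w m.
  rewrite /u /w; case: ifP => [cm|_]; last by rewrite lexx.
  have m_gt0 := core_gt0 cm.
  rewrite divr_ge0 ?normc_ge0 //=.
  have [->|t_gt0] := posnP (kroot k N).
    by rewrite invr0 mulr0 mulr_ge0 ?mulr_ge0 // invr_ge0 kthroot_ge0.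
  rewrite ler_pdivrMr ?ltr0n //; apply: le_trans (D_le _ _ m_gt0) _.
  apply: le_trans (ler_wpM2r K_ge0 (kroot_divn_le R k_gt0 N m_gt0)) _.
  by rewrite le_eqVlt; apply/orP; left; apply/eqP; ring.
have [C HC] := sum_core_kthrootV_le R k_gt0.
have u0 m : u m N @[N --> \oo] --> (0 : R).
  rewrite /u; case cm: (core k m); last exact: cvg_cst.
  have m_gt0 := core_gt0 cm.
  have /cvg_normc h := hinv m m_gt0.
  have hx : kroot k (N %/ m) @[N --> \oo] --> \oo.
    apply/cvgnyPge => A; exists (A ^ k * m)%N => // N /= hN.
    by rewrite leq_kroot_divn.
  (* u m N is the error of the mean of the fibre times kroot k (N %/ m) / t,
     a factor at most 1. *)
  apply: (squeeze_cvgr _ (cvg_cst 0) (cvg_comp _ _ hx h)).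
  apply: nearW => N /=; apply/andP; split; first by rewrite divr_ge0 ?normc_ge0.
  rewrite /D normc_mean_sub size_iota mulrAC ler_piMl ?normc_ge0 //.
  have [->|t_gt0] := posnP (kroot k N); first by rewrite invr0 mulr0.
  rewrite ler_pdivrMr ?ltr0n // mul1r ler_nat leq_kroot //.
  apply: leq_trans (leq_div N m); by rewrite -leq_kroot.
have key := @tannery R u w (2 * K * C) S uw _ u0.
apply/cvg_normc.
apply: (squeeze_cvgr _ (cvg_cst 0) (key _)); last first.
  move=> n; apply: le_trans (ler_wpM2l _ (HC n)); last by rewrite mulr_ge0.
  by rewrite big_distrr /= -big_mkcond.
exists 1%N => // N /= N_gt0; rewrite normc_ge0 /=.
set B := [seq n <- iota 1 N | _].
have pB := perm_kfull N k_gt0.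
have t_gt0 : (0 < kroot k N)%N by rewrite leq_kroot // exp1n.
have tB : (kroot k N <= size B)%N.
  (* The k-th powers, i.e. the fibre of the core 1. *)
  rewrite -[X in (X <= _)%N](size_iota 1) -(size_map (fun b => b ^ k)%N).
  apply: uniq_leq_size => [|_ /mapP[b + ->]].
    rewrite map_inj_uniq ?iota_uniq // => b b' /eqP.
    by rewrite eqn_exp2r // => /eqP.
  rewrite mem_filter !mem_iota !add1n !ltnS leq_kroot // => /andP[b_gt0 ->].
  by rewrite -[(b ^ k)%N]muln1 kfull_mul // muln1 expn_gt0 b_gt0.
have sB_gt0 := leq_trans t_gt0 tB.
rewrite mean_sub // Normc.normcM Normc.normcV normc_nat.
have sumB : Normc.normc (\sum_(n <- B) (a n - L)) <=
    \sum_(m <- [seq m <- iota 1 N | core k m]) D m (kroot k (N %/ m)).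
  by rewrite (perm_big _ pB) big_allpairs_dep; exact: normc_sum_le.
have -> : \sum_(0 <= m < N.+1) u m N =
    (\sum_(m <- [seq m <- iota 1 N | core k m]) D m (kroot k (N %/ m))) *
    (kroot k N)%:R^-1.
  rewrite big_distrl big_filter big_ltn // {1}/u /= add0r.
  by rewrite -big_mkcond /index_iota subSS subn0.
rewrite mulrC; apply: ler_pM => //; rewrite ?normc_ge0 ?invr_ge0 //.
by rewrite lef_pV2 ?posrE ?ltr0n // ler_nat.
Qed.
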